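(* Consider a set of producers $\mathcal N$, production cost functions $C_i$ for every $i\in\mathcal N$, and a demand function $D$. Then: (i) for every Nash equilibrium $x^*$ of the activation price game, the strategy profile $S^*$ with supply functions $$S_i^*(p)=[p-x_i^*]_+\,,\qquad\forall p\in[0,\hat p],$$ for every $i\in\mathcal N$, is a Nash equilibrium of the $\mathrm{Lip}_1$-pay-as-bid auction game; (ii) for every Nash equilibrium $S^*$ of the $\mathrm{Lip}_1$-pay-as-bid auction game, there exists a Nash equilibrium $x^*$ of the activation price game such that $$p^*(S^* )=\overline p(x^* )$$ and $$S_i^*(p)=[p-x_i^*]_+\,,\qquad\forall p\in[0,p^*(S^* )],$$ for every $i\in\mathcal N$.
   Context: Notation: $\mathbb R_+=[0,\infty)$, $[t]_+=\max\{t,0\}$. Market: $\mathcal N=\{1,\dots,n\}$ is a non-empty finite set of producers. Each production cost function $C_i:\mathbb R_+\to\mathbb R_+$ is twice continuously differentiable, non-decreasing and convex. The demand function $D:\mathbb R_+\to\mathbb R$ is twice continuously differentiable, strictly decreasing, with $D(0)>0$, $\hat p:=\sup\{p\ge 0: D(p)>0\}<+\infty$, and $D$ concave on $[0,\hat p]$. $\mathrm{Lip}_1$ is the set of non-decreasing functions $F:[0,\hat p]\to\mathbb R_+$ with $F(0)=0$ and $|F(x)-F(y)|\le|x-y|$ for all $x,y\in[0,\hat p]$. The $\mathrm{Lip}_1$-pay-as-bid auction game is the strategic game with player set $\mathcal N$, where each player $i$ chooses a supply function $S_i\in\mathrm{Lip}_1$. Given $S=(S_1,\dots,S_n)$, the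 market-clearing price $p^*(S)$ is the unique $p^*\in[0,\hat p]$ with $D(p^* )=\sum_{i=1}^n S_i(p^* )$, and the utility of player $i$ is $$u_i(S)=p^*S_i(p^* )-\int_0^{p^*}S_i(p)\,dp-C_i(S_i(p^* )),\qquad p^*=p^*(S).$$ Activation price game: the strategic game with player set $\mathcal N$, in which each player $i$ chooses $x_i\in[0,\hat p]$; for $x\in[0,\hat p]^{\mathcal N}$ the market-clearing price $\overline p(x)$ is the unique $\overline p\in[0,\hat p]$ with $D(\overline p)=\sum_{i=1}^n[\overline p-x_i]_+$, and the utility of player $i$ is $$\overline u_i(x)=\overline p\,[\overline p-x_i]_+-\tfrac12[\overline p-x_i]_+^2-C_i([\overline p-x_i]_+),\qquad \overline p=\overline p(x).$$ In both games, Nash equilibrium means pure strategy Nash equilibrium (each player's strategy maximizes its utility over its strategy space given the others' strategies). *)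

(* Defs.v *)
From HB Require Import structures.
From mathcomp Require Export all_boot all_order all_algebra.
From mathcomp Require Export all_classical all_reals all_analysis.
From mathcomp Require Import lra.
Export Order.TTheory GRing.Theory Num.Theory.
Export numFieldNormedType.Exports.

#[export] Set Implicit Arguments.
#[export] Unset Strict Implicit.
#[export] Unset Printing Implicit Defensive.

Local Open Scope classical_set_scope.
Local Open Scope ring_scope.

(* A function on R_+ (resp. on [0, phat]) is represented by a total function
   R -> R of which only the values on that set are constrained or used. *)

Definition pos_part (R : realType) (t : R) : R := Num.max t 0.

(* [f'] is the derivative of [f] along [A]: difference quotients are taken at
   points of [A] only, so the derivative is one-sided at an endpoint of [A]. *)
Definition is_derive_along (R : realType) (A : set R) (f f' : R -> R) : Prop :=
  forall x, A x -> (f y - f x) / (y - x) @[y --> within A x^'] --> f' x.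

Definition twice_continuously_differentiable_on (R : realType) (A : set R)
    (f : R -> R) : Prop :=
  exists f1 f2 : R -> R,
    [/\ is_derive_along A f f1, is_derive_along A f1 f2
      & {within A, continuous f2}].

Record is_cost_function (R : realType) (C : R -> R) : Prop := IsCostFunction {
  cost_ge0 : forall q, 0 <= q -> 0 <= C q;
  cost_C2 : twice_continuously_differentiable_on `[0, +oo[ C;
  cost_nondecreasing : forall q r, 0 <= q -> q <= r -> C q <= C r;
  cost_convex : convex_function (`[0, +oo[ : set R) C }.

Definition positive_demand_prices (R : realType) (D : R -> R) : set R :=
  [set p | 0 <= p /\ 0 < D p].

(* In R, [sup] has junk value 0 on empty or unbounded sets; for a demand
   function the set is non-empty and bounded. *)
Definition phat (R : realType) (D : R -> R) : R :=
  sup (positive_demand_prices D).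

Record is_demand_function (R : realType) (D : R -> R) : Prop :=
  IsDemandFunction {
  demand_C2 : twice_continuously_differentiable_on `[0, +oo[ D;
  demand_decreasing : forall p r, 0 <= p -> p < r -> D r < D p;
  demand_at0_gt0 : 0 < D 0;
  phat_finite : has_ubound (positive_demand_prices D);
  demand_concave : convex_function (`[0, phat D] : set R) (\- D) }.

(* Strategic games with player set [I], in which all players choose from the
   same strategy space [A]. *)

Definition deviate (I : eqType) (T : Type) (s : I -> T) (i : I) (t : T) :
    I -> T :=
  fun j => if j == i then t else s j.

Definition nash_equilibrium (R : realType) (I : eqType) (T : Type)
    (A : set T) (u : I -> (I -> T) -> R) (s : I -> T) : Prop :=
  (forall i, A (s i)) /\
  (forall i t, A t -> u i (deviate s i t) <= u i s).

(* "The" p in [0, phat] with D p = sum_i S_i p, by definite description; see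
   [clearing_price_exists] and [clearing_price_unique]. *)
Definition clearing_price (R : realType) (D : R -> R) (n : nat)
    (S : 'I_n -> R -> R) : R :=
  xget 0 [set p | 0 <= p <= phat D /\ D p = \sum_(i < n) S i p].

Definition Lip1 (R : realType) (D : R -> R) : set (R -> R) :=
  [set F | [/\ forall x, 0 <= x <= phat D -> 0 <= F x,
               forall x y, 0 <= x -> x <= y -> y <= phat D -> F x <= F y,
               F 0 = 0
             & forall x y, 0 <= x <= phat D -> 0 <= y <= phat D ->
                 `|F x - F y| <= `|x - y|]].

Definition pab_utility (R : realType) (n : nat) (C : 'I_n -> R -> R)
    (D : R -> R) (i : 'I_n) (S : 'I_n -> R -> R) : R :=
  let p := clearing_price D S in
  p * S i p - \int[lebesgue_measure]_(t in `[0, p]) S i t - C i (S i p).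

Definition Lip1_pab_nash (R : realType) (n : nat) (C : 'I_n -> R -> R)
    (D : R -> R) (S : 'I_n -> R -> R) : Prop :=
  nash_equilibrium (Lip1 D) (pab_utility C D) S.

Definition activation_supply (R : realType) (n : nat) (x : 'I_n -> R) :
    'I_n -> R -> R :=
  fun i p => pos_part (p - x i).

Definition activation_clearing_price (R : realType) (D : R -> R) (n : nat)
    (x : 'I_n -> R) : R :=
  clearing_price D (activation_supply x).

Definition activation_utility (R : realType) (n : nat) (C : 'I_n -> R -> R)
    (D : R -> R) (i : 'I_n) (x : 'I_n -> R) : R :=
  let p := activation_clearing_price D x in
  p * pos_part (p - x i) - 2^-1 * pos_part (p - x i) ^+ 2
  - C i (pos_part (p - x i)).

Definition activation_nash (R : realType) (n : nat) (C : 'I_n -> R -> R)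
    (D : R -> R) (x : 'I_n -> R) : Prop :=
  nash_equilibrium (`[0, phat D] : set R) (activation_utility C D) x.

Lemma is_derive_along_continuous (R : realType) (A : set R) (f f' : R -> R) :
  is_derive_along A f f' -> {within A, continuous f}.
Proof.
move=> df; apply/subspace_continuousP => x Ax.
have FA : Filter (within A x^') by exact: within_filter.
have h1 : (fun y => (f y - f x) / (y - x) * (y - x) + f x) y
    @[y --> within A x^'] --> f' x * 0 + f x.
  apply: cvgD; last exact: cvg_cst.
  apply: cvgM; first exact: df.
  rewrite -(subrr x); apply: cvgB; last exact: cvg_cst.
  apply: (@cvg_trans _ (nbhs x^')); last exact: cvg_within.
  exact: cvg_within.
rewrite mulr0 add0r in h1.
apply/cvgrPdist_lt => e e0.
have /cvgrPdist_lt/(_ e e0) := h1.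
rewrite !near_withinE => h.
near=> y => Ay.
have [->|yx] := eqVneq y x; first by rewrite subrr normr0.
have := near h y; rewrite yx => H.
have {}H := H _ _ Ay.
move: H; rewrite divfK ?subr_eq0// subrK; apply => //.
Unshelve. all: by end_near. Qed.

Lemma clearing_price_unique (R : realType) (D : R -> R) (n : nat)
    (S : 'I_n -> R -> R) (p q : R) :
  is_demand_function D -> (forall i, Lip1 D (S i)) ->
  0 <= p <= phat D -> D p = \sum_(i < n) S i p ->
  0 <= q <= phat D -> D q = \sum_(i < n) S i q ->
  p = q.
Proof.
move=> hD hS.
have lt_contra a b : 0 <= a -> a < b -> b <= phat D ->
    D a = \sum_(i < n) S i a -> D b = \sum_(i < n) S i b -> False.
  move=> a0 ab bP Da Db; have := demand_decreasing hD a0 ab.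
  rewrite Da Db ltNge ler_sum// => i _.
  by have [_ mS _ _] := hS i; apply: mS => //; exact: ltW.
move=> /andP[p0 pP] Dp /andP[q0 qP] Dq.
have [pq|qp|//] := ltgtP p q.
- by case: (lt_contra p q).
- by case: (lt_contra q p).
Qed.

Lemma phat_ge0 (R : realType) (D : R -> R) : is_demand_function D -> 0 <= phat D.
Proof.
move=> hD; apply: ub_le_sup; first exact: phat_finite hD.
by split => //; exact: demand_at0_gt0 hD.
Qed.

Lemma demand_phat_le0 (R : realType) (D : R -> R) :
  is_demand_function D -> D (phat D) <= 0.
Proof.
move=> hD; have P0 := phat_ge0 hD.
rewrite leNgt; apply/negP => DP.
have [f1 [f2 [/is_derive_along_continuous cD _ _]]] := demand_C2 hD.
have /subspace_continuousP/(_ (phat D)) := cD.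
rewrite /= in_itv/= andbT => /(_ P0) /cvgrPdist_lt/(_ _ DP).
rewrite near_withinE => -[e /= e0 he].
have := he (phat D + e / 2); rewrite /= opprD addNKr normrN gtr0_norm ?divr_gt0//.
rewrite ltr_pdivrMr// ltr_pMr// ltr1n in_itv/= andbT.
have e20 : 0 <= phat D + e / 2 by rewrite addr_ge0// divr_ge0// ltW.
move=> /(_ isT e20) hh.
have Dpos : 0 < D (phat D + e / 2).
  move: hh; rewrite ltr_norml => /andP[_]; rewrite ltrBlDr ltrDl.
  done.
have := ub_le_sup (phat_finite hD) (conj e20 Dpos : positive_demand_prices D _).
by rewrite -/(phat D) leNgt ltrDl divr_gt0.
Qed.

Lemma clearing_price_exists (R : realType) (D : R -> R) (n : nat)
    (S : 'I_n -> R -> R) :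
  is_demand_function D -> (forall i, Lip1 D (S i)) ->
  exists2 p, 0 <= p <= phat D & D p = \sum_(i < n) S i p.
Proof.
move=> hD hS; have P0 := phat_ge0 hD.
pose g p := D p - \sum_(i < n) S i p.
have [f1 [f2 [/is_derive_along_continuous cD _ _]]] := demand_C2 hD.
have cg : {within `[0, phat D], continuous g}.
  apply/subspace_continuousP => x /= xP.
  apply: cvgB.
    have sub : (`[0, phat D] : set R) `<=` `[0, +oo[.
      by move=> y /=; rewrite !in_itv/= andbT => /andP[].
    by move/(continuous_subspaceW sub)/subspace_continuousP : cD => /(_ _ xP).
  apply: cvg_big => [|i _]; first exact: add_continuous.
  have [_ _ _ LS] := hS i.
  apply/cvgrPdist_lt => e e0; rewrite near_withinE.
  exists e => //= y /= xy; rewrite in_itv/= => yP.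
  by apply: le_lt_trans xy; apply: LS => //; rewrite in_itv/= in xP.
have /(_ 0) [|c cP gc] := IVT P0 cg.
  apply/andP; split.
    rewrite ge_min; apply/orP; right; rewrite subr_le0.
    rewrite (le_trans (demand_phat_le0 hD))// sumr_ge0// => i _.
    by have [S0 _ _ _] := hS i; rewrite S0// lexx P0.
  rewrite le_max; apply/orP; left; rewrite /g big1 ?subr0 ?ltW//.
    exact: demand_at0_gt0 hD.
  by move=> i _; have [_ _ S0 _] := hS i.
exists c; first by rewrite in_itv/= in cP.
by apply/eqP; rewrite -subr_eq0; apply/eqP.
Qed.

Lemma activation_supply_Lip1 (R : realType) (D : R -> R) (n : nat)
    (x : 'I_n -> R) (i : 'I_n) : 0 <= x i -> Lip1 D (activation_supply x i).
Proof.
move=> x0; rewrite /activation_supply /pos_part; split.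
- by move=> y _; rewrite le_max lexx orbT.
- by move=> y z _ yz _; rewrite ge_max !le_max lexx orbT andbT lerD2r yz.
- by rewrite sub0r; apply/max_idPr; rewrite oppr_le0.
move=> y z _ _.
wlog yz : y z / z <= y.
  by move=> W; have [/W//|/ltW/W] := leP z y; rewrite distrC (distrC z).
rewrite (ger0_norm (_ : 0 <= y - z)) ?subr_ge0//.
by rewrite ler_norml; case: (leP (y - x i) 0); case: (leP (z - x i) 0); lra.
Qed.

(* Main.v *)
Require Import Defs.
From mathcomp Require Import ring lra.

(** Both games pay the same thing once price and quantity are fixed. If player
    [i] sells [q] at price [p] with the activation supply [t |-> [t - (p - q)]_+],
    the utility is [p q - q^2 / 2 - C_i q], called the payoff below. A Lip1
    supply [F] with [F p = q] is at least [[t - (p - q)]_+] on [[0, p]], because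
    its slope is at most 1 and it is nonnegative; since the pay-as-bid rule
    subtracts the integral of the supply, [F] earns at most the payoff
    ([pab_utility_le_payoff]).

    From activation to Lip1: a Lip1 deviation that clears at [p] with quantity
    [q] is therefore no better than the activation deviation [p - q], which
    clears at the same point.

    From Lip1 to activation: let [p] be the equilibrium price of [S] and
    [x_i = p - S_i p]. Replacing [S_i] by [[t - x_i]_+] preserves the market
    clearing point, so optimality of [S_i] forces the two integrals over
    [[0, p]] to be equal, and hence the two continuous functions to agree on
    [[0, p]]. Above [p] the slope bound gives [S_j t <= [t - x_j]_+]. Hence an
    activation deviation leading to price [c] and quantity [q] leaves, in the
    game with supplies [S_j], a residual demand of at least [q] at price [c].
    Offering [min t q] against the [S_j] then sells exactly [q] at some price
    [c' >= c]. The payoff at [(c', q)] is at least the one at [(c, q)], and it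
    is attained by an activation supply, so it is bounded by the equilibrium
    utility of [S] ([pab_nash_payoff_ge]). *)

Local Open Scope classical_set_scope.
Local Open Scope ring_scope.

(** * Positive parts and their integrals *)

Section PositivePart.
Context {R : realType}.
Implicit Types t x p : R.

Lemma pos_part_ge0 t : 0 <= pos_part t.
Proof. by rewrite /pos_part le_max lexx orbT. Qed.

Lemma ger0_pos_part t : 0 <= t -> pos_part t = t.
Proof. by move=> t0; apply/max_idPl. Qed.

Lemma ler0_pos_part t : t <= 0 -> pos_part t = 0.
Proof. by move=> t0; apply/max_idPr. Qed.

Lemma Rintegral_pos_part x p : 0 <= x -> 0 <= p ->
  \int[lebesgue_measure]_(t in `[0, p]) pos_part (t - x) =
  2^-1 * pos_part (p - x) ^+ 2.
Proof.
move=> x0 p0.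
(* The integrand is zero up to [x], and equal to [t - x] from there on. *)
have vanish q : q <= x ->
    \int[lebesgue_measure]_(t in `[0, q]) pos_part (t - x) = 0.
  move=> qx; rewrite (@eq_Rintegral _ _ _ _ _ (cst 0)); last first.
    move=> t; rewrite inE/= in_itv/= => /andP[_ tq].
    by rewrite ler0_pos_part// subr_le0 (le_trans tq).
  by rewrite Rintegral_cst// mul0r.
have [px|xp] := leP p x.
  by rewrite vanish// ler0_pos_part ?subr_le0// expr0n mulr0.
have cpos : continuous (fun t => pos_part (t - x)).
  move=> t; apply: (@continuous_max R R^o (fun t => t - x) (cst 0)).
    by apply: cvgB; [exact: cvg_id|exact: cvg_cst].
  exact: cvg_cst.
have ipos a b : lebesgue_measure.-integrable `[a, b]
    (EFin \o (fun t => pos_part (t - x))).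
  apply: continuous_compact_integrable; first exact: segment_compact.
  exact: continuous_subspaceT.
have ipos' : lebesgue_measure.-integrable `]x, p]
    (EFin \o (fun t => pos_part (t - x))).
  apply: integrableS (ipos x p) => //.
  by apply: subset_itvr; rewrite bnd_simp.
have /= := @Rintegral_itvB _ _ (BLeft 0) (BRight p) x (ipos 0 p).
rewrite !bnd_simp => /(_ x0 (ltW xp)).
rewrite (vanish x)// subr0 => ->.
rewrite Rintegral_itv_obnd_cbnd//.
have -> : \int[lebesgue_measure]_(t in `[x, p]) pos_part (t - x) =
    \int[lebesgue_measure]_(t in `[x, p]) (t - x).
  apply: eq_Rintegral => t; rewrite inE/= in_itv/= => /andP[xt _].
  by rewrite ger0_pos_part// subr_ge0.
rewrite ger0_pos_part ?subr_ge0 ?(ltW xp)//.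
pose G t := 2^-1 * (t - x) ^+ 2.
have dG t : is_derive t 1 G (t - x).
  rewrite /G; apply: is_derive_eq.
  by rewrite /GRing.scale/=; field.
have cG : continuous G.
  move=> t; apply: differentiable_continuous; apply/derivable1_diffP/ex_derive.
have FTC : (\int[lebesgue_measure]_(t in `[x, p]) (t - x)%:E =
    (G p)%:E - (G x)%:E)%E.
  apply: continuous_FTC2 => //.
  - apply: continuous_subspaceT => t.
    by apply: cvgB; [exact: cvg_id|exact: cvg_cst].
  - split.
    + by move=> t _.
    + by apply: cvg_at_right_filter; exact: cG.
    + by apply: cvg_at_left_filter; exact: cG.
  - by move=> t _; rewrite derive1E; exact: derive_val.
by rewrite /Rintegral FTC /G/= subrr expr0n mulr0 subr0.
Qed.
End PositivePart.

(** * Functions of Lip1 *)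

Section Lip1Functions.
Context {R : realType} (D : R -> R).
Implicit Types (p q t x : R) (F G : R -> R).

Lemma Lip1_le F t : Lip1 D F -> 0 <= t <= phat D -> F t <= t.
Proof.
move=> [_ _ F0 LF] tP; have /andP[t0 tP'] := tP.
have /(_ tP) := LF t 0; rewrite F0 !subr0 lexx (le_trans t0 tP')/= => /(_ isT).
by rewrite (ger0_norm t0); apply: le_trans; exact: ler_norm.
Qed.

Lemma Lip1_pos_part x : 0 <= x -> Lip1 D (fun t => pos_part (t - x)).
Proof.
exact: (@activation_supply_Lip1 R D 1 (fun=> x) ord0).
Qed.

(** The supply that offers [q] units as soon as the slope bound allows it. *)
Lemma Lip1_capped q : 0 <= q -> Lip1 D (fun t => Num.min t q).
Proof.
move=> q0; split.
- by move=> t /andP[t0 _]; rewrite le_min t0.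
- by move=> s t s0 st _; case: (leP s q); case: (leP t q); lra.
- exact/min_idPl.
move=> s t _ _; have := ler_norm (s - t); have := ler_norm (t - s).
rewrite (distrC t) ler_norml.
by case: (leP s q); case: (leP t q); lra.
Qed.

Lemma Lip1_increment F s t : Lip1 D F ->
  0 <= s -> s <= t -> t <= phat D -> F t - F s <= t - s.
Proof.
move=> [_ _ _ LF] s0 st tP.
have := LF t s; rewrite (le_trans s0 st) tP s0 (le_trans st tP) => /(_ isT isT).
by rewrite (@ger0_norm _ (t - s)) ?subr_ge0//; apply: le_trans; exact: ler_norm.
Qed.

(** Among the Lip1 functions through [(p, F p)], the activation supply is the
    smallest one to the left of [p], and the largest one to its right. *)
Lemma pos_part_le_Lip1 F p t : Lip1 D F -> 0 <= t -> t <= p -> p <= phat D ->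
  pos_part (t - (p - F p)) <= F t.
Proof.
move=> LF t0 tp pP; rewrite /pos_part ge_max; apply/andP; split.
  by have := Lip1_increment LF t0 tp pP; lra.
by case: LF => F0 _ _ _; rewrite F0// t0 (le_trans tp pP).
Qed.

Lemma Lip1_le_pos_part F p t : Lip1 D F -> 0 <= p -> p <= t -> t <= phat D ->
  F t <= pos_part (t - (p - F p)).
Proof.
move=> LF p0 pt tP; rewrite /pos_part le_max; apply/orP; left.
by have := Lip1_increment LF p0 pt tP; lra.
Qed.

Lemma Lip1_integrable F p : Lip1 D F -> p <= phat D ->
  lebesgue_measure.-integrable `[0, p] (EFin \o F).
Proof.
move=> [_ _ _ LF] pP.
apply: continuous_compact_integrable; first exact: segment_compact.
have sub t : `[0, p]%classic t -> 0 <= t <= phat D.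
  by rewrite /= in_itv/= => /andP[-> tp]; exact: le_trans pP.
apply/subspace_continuousP => s /sub sP.
apply/cvgrPdist_lt => e e0; rewrite near_withinE.
by exists e => //= t st /sub tP; apply: le_lt_trans st; exact: LF.
Qed.

Lemma Rintegral_ge_rectangle G p s t c :
  lebesgue_measure.-integrable `[0, p] (EFin \o G) ->
  (forall r, 0 <= r <= p -> 0 <= G r) ->
  0 <= s -> s <= t -> t <= p ->
  (forall r, s <= r <= t -> c <= G r) ->
  c * (t - s) <= \int[lebesgue_measure]_(r in `[0, p]) G r.
Proof.
move=> iG G0 s0 st tp cG.
have sub : (`[s, t] : set R) `<=` `[0, p].
  by apply: subset_itv; rewrite bnd_simp.
have -> : c * (t - s) = \int[lebesgue_measure]_(r in `[s, t]) c.
  rewrite Rintegral_cst//= lebesgue_measure_itv/= lte_fin.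
  case: ltP => //= ts; have -> : t = s by apply/le_anti; rewrite ts st.
  by rewrite subrr.
have iGs : lebesgue_measure.-integrable `[s, t] (EFin \o G).
  exact: integrableS iG.
apply: (@le_trans _ _ (\int[lebesgue_measure]_(r in `[s, t]) G r)).
  apply: le_Rintegral => //.
    apply: continuous_compact_integrable; first exact: segment_compact.
    by apply: continuous_subspaceT => r; exact: cvg_cst.
apply: fine_le.
- exact: integrable_fin_num.
- exact: integrable_fin_num.
- by apply: ge0_subset_integral => //; case/integrableP: iG.
Qed.

(** If the inequality were strict at [t], with gap [e], then [F - G] would
    be at least [e / 2] on the interval of length [e / 2] ending at [t]. *)
Lemma Lip1_eq_of_Rintegral F G p : Lip1 D F -> Lip1 D G -> p <= phat D ->
  (forall t, 0 <= t <= p -> G t <= F t) ->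
  \int[lebesgue_measure]_(t in `[0, p]) F t <=
  \int[lebesgue_measure]_(t in `[0, p]) G t ->
  forall t, 0 <= t <= p -> F t = G t.
Proof.
move=> LF LG pP GF intFG t /andP[t0 tp].
apply/le_anti; rewrite GF ?t0// andbT leNgt; apply/negP => GFt.
have [iF iG] := (Lip1_integrable LF pP, Lip1_integrable LG pP).
pose e := F t - G t.
have e0 : 0 < e by rewrite subr_gt0.
have tP : t <= phat D := le_trans tp pP.
have et : e <= t.
  have := Lip1_le LF; move=> /(_ t); rewrite t0 tP => /(_ isT).
  by case: LG => /(_ t); rewrite t0 tP => /(_ isT); rewrite /e; lra.
(* The rectangle stays inside [[0, p]] because [e <= F t <= t]. *)
have s0 : 0 <= t - e / 2 by lra.
have rect : e / 2 * (t - (t - e / 2)) <=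
    \int[lebesgue_measure]_(r in `[0, p]) (F r - G r).
  apply: Rintegral_ge_rectangle => //.
  - by apply: (integrableB _ iF iG).
  - by move=> r rp; rewrite subr_ge0; exact: GF.
  - by lra.
  move=> r /andP[sr rt].
  have r0 : 0 <= r by lra.
  (* Left of [t], [F] drops at slope at most 1 while [G] does not increase. *)
  have := Lip1_increment LF r0 rt tP.
  case: LG => _ /(_ r t r0 rt tP) + _ _.
  by rewrite /e in sr *; lra.
move: rect; rewrite RintegralB// => rect.
have : 0 < e / 2 * (t - (t - e / 2)) by rewrite mulr_gt0; lra.
by lra.
Qed.

End Lip1Functions.

(** * Market clearing and utilities *)

Section Games.
Context {R : realType} {n : nat} {D : R -> R} (hD : is_demand_function D).
Context (C : 'I_n -> R -> R).
Implicit Types (S : 'I_n -> R -> R) (x : 'I_n -> R) (i : 'I_n).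

Lemma clearing_priceP S : (forall i, Lip1 D (S i)) ->
  0 <= clearing_price D S <= phat D /\
  D (clearing_price D S) = \sum_(i < n) S i (clearing_price D S).
Proof.
move=> LS; have [p pP Dp] := clearing_price_exists hD LS.
apply: (@xgetPex _ 0 [set p | 0 <= p <= phat D /\ D p = \sum_(i < n) S i p]).
by exists p.
Qed.

Lemma clearing_price_eq S p : (forall i, Lip1 D (S i)) ->
  0 <= p <= phat D -> D p = \sum_(i < n) S i p -> clearing_price D S = p.
Proof.
move=> LS pP Dp; have [cP Dc] := clearing_priceP LS.
exact: clearing_price_unique hD LS cP Dc pP Dp.
Qed.

Lemma Lip1_deviate S i F : (forall j, Lip1 D (S j)) -> Lip1 D F ->
  forall j, Lip1 D (deviate S i F j).
Proof. by move=> LS LF j; rewrite /deviate; case: ifP. Qed.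

Lemma sum_deviate S i F p :
  \sum_(j < n) deviate S i F j p = F p + \sum_(j < n | j != i) S j p.
Proof.
rewrite (bigD1 i)//= /deviate eqxx; congr (_ + _).
by apply: eq_bigr => j /negbTE ->.
Qed.

Lemma deviate_activation_supply x i y :
  deviate (activation_supply x) i (fun p => pos_part (p - y)) =
  activation_supply (deviate x i y).
Proof.
by apply/funext => j; rewrite /deviate /activation_supply; case: ifP.
Qed.

(** The utility of player [i] when it sells [q] at price [p] with the activation
    supply of threshold [p - q]. *)
Definition payoff i (p q : R) : R := p * q - 2^-1 * q ^+ 2 - C i q.

Lemma activation_utilityE x i : (forall j, 0 <= x j) ->
  activation_utility C D i x = pab_utility C D i (activation_supply x).
Proof.
move=> x0; rewrite /activation_utility /pab_utility /activation_clearing_price.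
have [/andP[p0 _] _] :=
  clearing_priceP (fun j => activation_supply_Lip1 D (x0 j)).
by rewrite Rintegral_pos_part.
Qed.

Lemma eq_pab_utility S S' i : (forall j, Lip1 D (S j)) ->
  (forall j, Lip1 D (S' j)) ->
  (forall j p, 0 <= p <= phat D -> S j p = S' j p) ->
  pab_utility C D i S = pab_utility C D i S'.
Proof.
move=> LS LS' SS'; have [cP Dc] := clearing_priceP LS.
have pp : clearing_price D S' = clearing_price D S.
  apply: clearing_price_eq => //; rewrite Dc.
  by apply: eq_bigr => j _; exact: SS'.
rewrite /pab_utility pp SS'//; congr (_ - _ - _).
apply: eq_Rintegral => t; rewrite inE/= in_itv/= => /andP[t0 tp].
by apply: SS'; case/andP: cP => _; rewrite t0; exact: le_trans.
Qed.

(** Any point [(p, q)] of the residual demand curve of player [i] with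
    [0 <= q <= p] is reached by an activation supply. *)
Lemma payoff_pos_part S i p q : (forall j, Lip1 D (S j)) ->
  0 <= p <= phat D -> 0 <= q <= p ->
  D p = q + \sum_(j < n | j != i) S j p ->
  pab_utility C D i (deviate S i (fun t => pos_part (t - (p - q)))) =
  payoff i p q.
Proof.
move=> LS pP /andP[q0 qp] Dp; have /andP[p0 _] := pP.
have x0 : 0 <= p - q by rewrite subr_ge0.
have qE : pos_part (p - (p - q)) = q by rewrite subKr ger0_pos_part.
have cpE : clearing_price D
    (deviate S i (fun t => pos_part (t - (p - q)))) = p.
  apply: clearing_price_eq => //.
    by apply: Lip1_deviate => //; exact: Lip1_pos_part.
  by rewrite sum_deviate qE.
by rewrite /pab_utility cpE /deviate eqxx Rintegral_pos_part// qE.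
Qed.

Lemma pab_utility_le_payoff S i : (forall j, Lip1 D (S j)) ->
  let p := clearing_price D S in
  pab_utility C D i S <= payoff i p (S i p).
Proof.
move=> LS /=; rewrite /pab_utility /payoff.
have [/andP[p0 pP] _] := clearing_priceP LS.
set p := clearing_price D S in p0 pP *.
have Sp := Lip1_le (LS i); have {}Sp : S i p <= p by rewrite Sp ?p0.
have x0 : 0 <= p - S i p by rewrite subr_ge0.
have S0 : 0 <= S i p by case: (LS i) => + _ _ _; apply; rewrite p0.
rewrite lerD2r lerD2l lerN2.
have := Rintegral_pos_part x0 p0.
rewrite subKr ger0_pos_part// => <-.
apply: le_Rintegral => //.
- exact: Lip1_integrable (Lip1_pos_part D x0) pP.
- exact: Lip1_integrable (LS i) pP.
- move=> t; rewrite /= in_itv/= => /andP[t0 tp].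
  exact: pos_part_le_Lip1.
Qed.

(** The market-clearing equation, with the supply of player [i] set apart. *)
Lemma residual_demand S i : (forall j, Lip1 D (S j)) ->
  let p := clearing_price D S in
  D p = S i p + \sum_(j < n | j != i) S j p.
Proof. by move=> /clearing_priceP[_ Dp] p; rewrite [LHS]Dp (bigD1 i). Qed.

(** * From activation equilibria to Lip1 equilibria *)

Lemma activation_nash_pab x S : activation_nash C D x ->
  (forall i p, 0 <= p <= phat D -> S i p = pos_part (p - x i)) ->
  Lip1_pab_nash C D S.
Proof.
move=> [xP nx] Sx.
have x0 i : 0 <= x i by have := xP i; rewrite /= in_itv/= => /andP[].
have Lx i : Lip1 D (activation_supply x i) by exact: activation_supply_Lip1.
have P0 := phat_ge0 hD.
have LS i : Lip1 D (S i).
  have [h1 h2 h3 h4] := Lx i; split.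
  - by move=> t tP; rewrite Sx//; exact: h1.
  - move=> s t s0 st tP; rewrite !Sx ?s0 ?(le_trans s0 st) ?(le_trans st tP)//.
    exact: h2.
  - by rewrite Sx ?lexx//; exact: h3.
  - by move=> s t sP tP; rewrite !Sx//; exact: h4.
split=> // i T LT.
set S' := deviate S i T.
have LS' : forall j, Lip1 D (S' j) by exact: Lip1_deviate.
have [pP _] := clearing_priceP LS'.
have Dp := residual_demand i LS'.
apply: (le_trans (pab_utility_le_payoff i LS')).
set p := clearing_price D S' in pP Dp *.
have /andP[p0 pP'] := pP.
have S'i : S' i = T by rewrite /S' /deviate eqxx.
rewrite S'i in Dp *.
have T0 : 0 <= T p by case: LT => + _ _ _; exact.
have Tp : T p <= p := Lip1_le LT pP.
have y0 : 0 <= p - T p by rewrite subr_ge0.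
have Dp' : D p = T p + \sum_(j < n | j != i) activation_supply x j p.
  rewrite Dp; congr (_ + _); apply: eq_bigr => j ji.
  by rewrite /S' /deviate (negbTE ji) Sx.
rewrite -(payoff_pos_part Lx pP _ Dp') ?T0 ?Tp//.
rewrite deviate_activation_supply -activation_utilityE; last first.
  by move=> j; rewrite /deviate; case: ifP.
rewrite (eq_pab_utility i LS Lx Sx) -activation_utilityE//.
by apply: nx; rewrite /= in_itv/= y0/=; lra.
Qed.

(** * From Lip1 equilibria to activation equilibria *)

Lemma pab_nash_activation_supply S i p t : Lip1_pab_nash C D S ->
  p = clearing_price D S ->
  0 <= t <= p -> S i t = pos_part (t - (p - S i p)).
Proof.
move=> [LS nS] pE.
have [pP _] := clearing_priceP LS; have Dp := residual_demand i LS.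
rewrite -pE /= in pP Dp; have /andP[p0 pP'] := pP.
have S0 : 0 <= S i p by case: (LS i) => + _ _ _; exact.
have Sp : S i p <= p := Lip1_le (LS i) pP.
have x0 : 0 <= p - S i p by rewrite subr_ge0.
have := nS i _ (Lip1_pos_part D x0).
rewrite payoff_pos_part ?S0 ?Sp//.
rewrite /pab_utility -pE /payoff lerD2r lerD2l lerN2 => intS.
apply: (Lip1_eq_of_Rintegral (LS i) (Lip1_pos_part D x0) pP').
  by move=> s /andP[s0 sp]; exact: pos_part_le_Lip1.
by rewrite Rintegral_pos_part// subKr ger0_pos_part.
Qed.

(** A player who faces a residual demand of at least [q] at price [p] can sell
    [q] at a price not below [p], so its equilibrium utility is at least the
    payoff at [(p, q)]. *)
Lemma pab_nash_payoff_ge S i p q : Lip1_pab_nash C D S ->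
  0 <= p <= phat D -> 0 <= q <= p ->
  q + \sum_(j < n | j != i) S j p <= D p ->
  payoff i p q <= pab_utility C D i S.
Proof.
move=> [LS nS] /andP[p0 pP] /andP[q0 qp] Dp.
pose T t := Num.min t q.
have LT : Lip1 D T by exact: Lip1_capped.
have LS' := Lip1_deviate i LS LT.
have [cP Dc] := clearing_priceP LS'.
set c := clearing_price D (deviate S i T) in cP Dc.
have /andP[c0 cP'] := cP.
have pc : p <= c.
  rewrite leNgt; apply/negP => cp.
  have := demand_decreasing hD c0 cp.
  rewrite Dc sum_deviate ltNge => /negP; apply.
  apply: le_trans Dp; apply: lerD; first by rewrite /T ge_min lexx orbT.
  by apply: ler_sum => j _; case: (LS j) => _ + _ _; apply => //; exact: ltW.
have Tc : T c = q by apply/min_idPr; exact: le_trans pc.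
have y0 : 0 <= c - q by rewrite subr_ge0 (le_trans qp).
have := nS i _ (Lip1_pos_part D y0).
rewrite payoff_pos_part//; last 2 first.
- by rewrite q0 (le_trans qp).
- by rewrite Dc sum_deviate Tc.
by apply: le_trans; rewrite /payoff !lerD2r ler_wpM2r.
Qed.

Lemma pab_nash_activation S : Lip1_pab_nash C D S ->
  exists x, [/\ activation_nash C D x,
    clearing_price D S = activation_clearing_price D x
  & forall i p, 0 <= p <= clearing_price D S -> S i p = pos_part (p - x i)].
Proof.
move=> NS; have [LS nS] := NS.
have [pP Dp] := clearing_priceP LS.
set p := clearing_price D S in pP Dp *; have /andP[p0 pP'] := pP.
pose x i := p - S i p.
have S0 i : 0 <= S i p by case: (LS i) => + _ _ _; exact.
have x0 i : 0 <= x i by rewrite subr_ge0; exact: Lip1_le (LS i) pP.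
have Sx i t : 0 <= t <= p -> S i t = pos_part (t - x i).
  exact: pab_nash_activation_supply NS erefl.
have Lx i : Lip1 D (activation_supply x i) by exact: activation_supply_Lip1.
have px : activation_clearing_price D x = p.
  apply: clearing_price_eq => //; rewrite Dp.
  by apply: eq_bigr => i _; rewrite Sx ?p0 ?lexx.
(* The replacement of the [S_j] by activation supplies can only lower the
   residual demand of each player. *)
have S_le i t : 0 <= t <= phat D -> S i t <= activation_supply x i t.
  move=> /andP[t0 tP]; have [tp|/ltW pt] := leP t p; first by rewrite Sx ?t0.
  exact: Lip1_le_pos_part.
exists x; split => //; split.
  move=> i; rewrite /= in_itv/= x0/= /x; have := S0 i; lra.
move=> i y; rewrite /= in_itv/= => /andP[y0 _].
have dev0 j : 0 <= deviate x i y j by rewrite /deviate; case: ifP.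
have Ldev j : Lip1 D (activation_supply (deviate x i y) j).
  exact: activation_supply_Lip1.
have -> : activation_utility C D i x = pab_utility C D i S.
  rewrite activation_utilityE// /pab_utility.
  rewrite -/(activation_clearing_price D x) px -/p.
  have -> : activation_supply x i p = S i p by rewrite Sx ?p0 ?lexx.
  congr (_ - _ - _); apply: eq_Rintegral => t.
  by rewrite inE/= in_itv/= => tp; rewrite Sx.
have [cP _] := clearing_priceP Ldev; have := residual_demand i Ldev.
rewrite /activation_utility -/(activation_clearing_price D _) /= in cP *.
set c := activation_clearing_price D (deviate x i y) in cP *.
move=> Dc; have -> : deviate x i y i = y by rewrite /deviate eqxx.
have /andP[c0 _] := cP.
apply: (pab_nash_payoff_ge NS cP).
  by rewrite pos_part_ge0/= /pos_part ge_max c0 andbT; lra.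
rewrite Dc {1}/activation_supply {1}/deviate eqxx lerD2l.
apply: ler_sum => j ji; rewrite {1}/activation_supply {1}/deviate (negbTE ji).
exact: S_le.
Qed.

End Games.

Theorem proposition4 (R : realType) (n : nat) (hn : (0 < n)%N)
    (C : 'I_n -> R -> R) (D : R -> R)
    (hC : forall i, is_cost_function (C i)) (hD : is_demand_function D) :
  (forall x : 'I_n -> R, activation_nash C D x ->
     forall S : 'I_n -> R -> R,
       (forall (i : 'I_n) (p : R), 0 <= p <= phat D -> S i p = pos_part (p - x i)) ->
       Lip1_pab_nash C D S)
  /\
  (forall S : 'I_n -> R -> R, Lip1_pab_nash C D S ->
     exists x : 'I_n -> R,
       [/\ activation_nash C D x,
           clearing_price D S = activation_clearing_price D x
         & forall (i : 'I_n) (p : R), 0 <= p <= clearing_price D S ->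
             S i p = pos_part (p - x i)]).
Proof.
split=> [x nx S Sx|S nS].
- exact: (activation_nash_pab hD nx Sx).
- exact: (pab_nash_activation hD nS).
Qed.
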